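(* Let $n$ be a positive integer with $n \equiv 3 \pmod{4}$. Then $h(n) = (n-3)/2$ or $h(n) = (n-1)/2$.
   Context: $A_n$ is the alternating group of degree $n$, acting on $\mathbb{Z}_n = \mathbb{Z}/n\mathbb{Z} = \{0,1,\ldots,n-1\}$. Permutations act on the right (the image of $x$ under $\pi$ is $x^\pi$) and are composed from left to right. For $n$ odd, let $c = (0,1,\ldots,n-1) \in A_n$, i.e. $x^c = x+1$. For $\pi \in A_n$, $[\pi] = \langle c\rangle \pi$ is the coset of $\langle c \rangle$ containing $\pi$; its elements are the permutations $c^j\pi$ (first $c^j$, then $\pi$). Define $h(\pi)$ to be the minimum number of 3-cycles in an expression of $\pi$ as a product of (not necessarily disjoint) 3-cycles in $A_n$, with $h(\mathrm{id}) = 0$. Define $h([\pi]) = \min_{\sigma \in [\pi]} h(\sigma) = \min_{0 \le j \le n-1} h(c^j\pi)$ and $h(n) = \max_{\pi \in A_n} h([\pi])$. *)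

(* Defs.v *)
From mathcomp Require Import all_boot fingroup perm cyclic alt.

Set Implicit Arguments.
Unset Strict Implicit.
Unset Printing Implicit Defensive.

Local Open Scope group_scope.

Definition is_3cycle (T : finType) (s : {perm T}) : bool :=
  [exists x, exists y, exists z,
    [&& uniq [:: x; y; z], s x == y, s y == z, s z == x
      & [forall t, (t \notin [:: x; y; z]) ==> (s t == t)]]].

Definition prod_3cycles (T : finType) (k : nat) (s : {perm T}) : bool :=
  [exists u : k.-tuple {perm T}, all (@is_3cycle T) u && (s == \prod_(t <- u) t)].

Lemma prod_3cyclesP (T : finType) (k : nat) (s : {perm T}) :
  reflect (exists u : seq {perm T},
             [/\ size u = k, all (@is_3cycle T) u & s = \prod_(t <- u) t])
          (prod_3cycles k s).
Proof.
apply: (iffP existsP) => [[u /andP[u3 /eqP->]]|[u [uk u3 ->]]].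
  by exists u; rewrite size_tuple.
by move/eqP: uk => uk; exists (Tuple uk); rewrite u3 /=.
Qed.

Lemma prod_3cyclesM (T : finType) (j k : nat) (s t : {perm T}) :
  prod_3cycles j s -> prod_3cycles k t -> prod_3cycles (j + k) (s * t).
Proof.
move=> /prod_3cyclesP[u [<- u3 ->]] /prod_3cyclesP[v [<- v3 ->]].
by apply/prod_3cyclesP; exists (u ++ v); rewrite size_cat all_cat u3 v3 big_cat.
Qed.

Lemma prod_3cycles1 (T : finType) : prod_3cycles 0 (1 : {perm T}).
Proof. by apply/prod_3cyclesP; exists [::]; rewrite big_nil. Qed.

Lemma tperm2_prod_3cycles (T : finType) (x y z : T) :
  x != y -> x != z -> exists k, prod_3cycles k (tperm x y * tperm x z).
Proof.
move=> nxy nxz; have [<-|nyz] := eqVneq y z.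
  by exists 0; rewrite tperm2 prod_3cycles1.
exists 1%N; apply/prod_3cyclesP; exists [:: tperm x y * tperm x z].
rewrite big_seq1 /= andbT; split=> //.
apply/existsP; exists x; apply/existsP; exists y; apply/existsP; exists z.
rewrite /= !inE negb_or nxy nxz nyz !permM !tpermL !tpermR tpermL.
rewrite (tpermD nxz nyz) tpermR (tpermD nxy) 1?eq_sym // !eqxx /=.
apply/forallP=> t; rewrite !inE !negb_or ![t == _]eq_sym permM.
by apply/implyP=> /and3P[nxt nyt nzt]; rewrite !tpermD.
Qed.

Lemma Alt_prod_3cycles (T : finType) (s : {perm T}) :
  s \in 'Alt_T -> exists k, prod_3cycles k s.
Proof.
rewrite Alt_even; case: (prod_tpermP s) => ts -> dts.
rewrite odd_perm_prod //; have [m] := ubnP (size ts).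
elim: m ts dts => // m IHm [|[x y] [|[z w] ts]] //= => [_ _ _|].
  by exists 0; rewrite big_nil prod_3cycles1.
rewrite /dpair /= => /and3P[nxy nzw dts] lt_m; rewrite negbK => ev.
have [k kP] := IHm ts dts (ltnW lt_m) ev.
rewrite !big_cons mulgA /=.
suff [j jP] : exists j, prod_3cycles j (tperm x y * tperm z w).
  by exists (j + k)%N; apply: prod_3cyclesM.
case: (eqVneq z x) => [ezx|nzx]; first by rewrite ezx in nzw *; exact: tperm2_prod_3cycles.
have nxz : x != z by rewrite eq_sym.
have [i iP] := tperm2_prod_3cycles nxy nxz.
have [j jP] := tperm2_prod_3cycles nzx nzw.
exists (i + j)%N; have := prod_3cyclesM iP jP.
by rewrite [tperm z x]tpermC -mulgA (mulgA (tperm x z)) tperm2 mul1g.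
Qed.

Lemma h_perm_exists (T : finType) (s : {perm T}) :
  exists k, (s \in 'Alt_T) ==> prod_3cycles k s.
Proof.
have [/Alt_prod_3cycles[k kP]|_] := boolP (s \in 'Alt_T); first by exists k.
by exists 0.
Qed.

(* The minimal number of 3-cycles with product s, for s even. The value is 0
   for s odd, but only even permutations are used below: see [shift_Alt]. *)
Definition h_perm (T : finType) (s : {perm T}) : nat :=
  ex_minn (h_perm_exists s).

(* [ordS] is x |-> x + 1 mod n, so this is the cycle (0, 1, ..., n - 1). *)
Definition shift (n : nat) : {perm 'I_n} := perm (@ordS_inj n).

Lemma shift_Alt (n : nat) : odd n -> shift n \in 'Alt_('I_n).
Proof.
move=> on; rewrite Alt_even.
have vE k (x : 'I_n) : (shift n ^+ k) x = (x + k) %% n :> nat.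
  elim: k => [|k IHk]; first by rewrite expg0 perm1 addn0 modn_small.
  by rewrite expgSr permM permE /= IHk -addn1 modnDml addn1 addnS.
have : shift n ^+ n = 1.
  by apply/permP=> x; apply/ord_inj; rewrite vE perm1 /= modnDr modn_small.
move/(congr1 (@odd_perm _)); rewrite odd_perm1.
suff -> k : odd_perm (shift n ^+ k) = odd k && odd_perm (shift n).
  by rewrite on /= => ->.
elim: k => [|k IHk]; first by rewrite expg0 odd_perm1.
by rewrite expgS odd_permM IHk /=; case: (odd k); case: (odd_perm _).
Qed.

(* Permutations compose from left to right, (s * t) x = t (s x), so the right
   coset <[shift n]> :* s consists of the c ^+ j * s with c := shift n.
   Since s itself lies in it, the default value h_perm s does not affect the
   minimum. *)
Definition h_coset (n : nat) (s : {perm 'I_n}) : nat :=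
  \big[minn/h_perm s]_(t in <[shift n]> :* s) h_perm t.

Definition h_max (n : nat) : nat :=
  \max_(s in 'Alt_('I_n)) h_coset s.

(* Main.v *)
(** The number of 3-cycles needed for an even permutation of n points is
    (n - o) / 2, where o is the number of its orbits of odd size.

    Each 3-cycle can fix two more points, except that a pair of transpositions
    uses two 3-cycles for four points; hence h <= n / 2.

    Conversely, composing with a 3-cycle affects only the orbits through three
    points, so it destroys at most three odd orbits, and at most two because o
    has the parity of n.

    Let r be the reflection x |-> n - 1 - x. Each c^j r is an involution with at
    most one fixed point, so it has at most one odd orbit. If r is odd, r
    followed by a transposition is even, and the transposition creates at most
    two odd orbits in each c^j r. Hence h >= (n - 3) / 2 on the whole coset. *)
Require Import Defs.
From mathcomp Require Import all_boot.
From mathcomp Require Import fingroup perm action alt zify.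

Set Implicit Arguments.
Unset Strict Implicit.
Unset Printing Implicit Defensive.

(** * Odd orbits and products of 3-cycles *)

Lemma porbit_eq_in (T : finType) (s t : {perm T}) (x : T) :
  {in porbit s x, s =1 t} -> porbit s x = porbit t x.
Proof.
move=> est; have eX i : ((t ^+ i) x = (s ^+ i) x)%g.
  elim: i => [|i IHi]; first by rewrite !expg0.
  by rewrite !expgSr !permM IHi est // mem_porbit.
by apply/setP=> y; apply/porbitP/porbitP=> -[i ->]; exists i; rewrite eX.
Qed.

Definition odd_porbits (T : finType) (s : {perm T}) : {set {set T}} :=
  [set A in porbits s | odd #|A|].

Lemma partition_porbits (T : finType) (s : {perm T}) :
  partition (porbits s) [set: T].
Proof.
have -> : porbits s = [set orbit 'P <[s]> x | x in [set: T]].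
  apply/setP=> A; apply/imsetP/imsetP=> -[x _ ->]; exists x => //;
  by rewrite porbit.unlock orbitE.
by apply: orbit_partition; apply/actsP=> a _ x; rewrite !inE.
Qed.

(** The orbit sizes add up to [#|T|], and modulo 2 each odd orbit contributes 1 and each even one
    0. *)
Lemma odd_card_odd_porbits (T : finType) (s : {perm T}) :
  odd #|odd_porbits s| = odd #|T|.
Proof.
rewrite -cardsT (card_partition (partition_porbits s)).
rewrite (eq_bigr (fun A : {set T} => odd #|A| + #|A|./2.*2)); last first.
  by move=> A _; rewrite odd_double_half.
rewrite big_split oddD -(big_morph double doubleD (erefl : 0.*2 = 0)).
rewrite odd_double addbF; congr odd.
rewrite -sum1_card big_mkcond [RHS]big_mkcond /=.
by apply: eq_bigr => A _; rewrite inE; case: (A \in _); case: odd.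
Qed.

(** An orbit of [s] that avoids [D] is also an orbit of [t]; every other one is the orbit of a point
    of [D]. *)
Lemma card_odd_porbits_le (T : finType) (s t : {perm T}) (D : {set T}) :
  {in ~: D, s =1 t} -> #|odd_porbits s| <= #|odd_porbits t| + #|D|.
Proof.
move=> est.
have sub : odd_porbits s \subset odd_porbits t :|: [set porbit s x | x in D].
  apply/subsetP=> A; rewrite !inE => /andP[/imsetP[x _ ->] ox].
  have [/existsP[y /andP[yD xy]]|nD] :=
    boolP [exists y, (y \in D) && (y \in porbit s x)].
    apply/orP; right; apply/imsetP; exists y => //.
    by apply/eqP; rewrite eq_porbit_mem porbit_sym.
  have e : porbit s x = porbit t x.
    apply: porbit_eq_in => y xy; apply: est; rewrite inE; apply: contra nD => yD.
    by apply/existsP; exists y; rewrite yD.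
  by rewrite ox andbT {1}e imset_f.
apply: leq_trans (subset_leq_card sub) _.
apply: leq_trans (leq_card_setU _ _) _.
by rewrite leq_add2l leq_imset_card.
Qed.

Lemma card_odd_porbits1 (T : finType) : #|odd_porbits (1%g : {perm T})| = #|T|.
Proof.
have p1 (x : T) : porbit 1%g x = [set x].
  apply/setP=> y; rewrite inE; apply/porbitP/eqP=> [[i ->]|->].
    by rewrite expg1n perm1.
  by exists 0; rewrite perm1.
have -> : odd_porbits (1%g : {perm T}) = [set [set x] | x in T].
  apply/setP=> A; rewrite inE; apply/andP/imsetP=> [[/imsetP[x _ ->] _]|[x _ ->]].
    by exists x; rewrite ?p1.
  by rewrite -{1}p1 imset_f // cards1.
by rewrite card_imset //; exact: set1_inj.
Qed.

Lemma odd_porbits_mul3 (T : finType) (c s : {perm T}) : is_3cycle c ->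
  #|odd_porbits s| <= #|odd_porbits (c * s)%g| + 2.
Proof.
move=> /existsP[x /existsP[y /existsP[z /and5P[_ _ _ _ /forallP fix_c]]]].
have est : {in ~: [set t in [:: x; y; z]], s =1 (c * s)%g}.
  move=> t; rewrite in_setC in_set => tD.
  by rewrite permM (eqP (implyP (fix_c t) tD)).
have leD : #|[set t in [:: x; y; z]]| <= 3 by rewrite cardsE; exact: card_size.
have le3 := card_odd_porbits_le est.
(* Both counts have the parity of [#|T|], so a loss of at most 3 is a loss of at most 2. *)
have := odd_card_odd_porbits s; rewrite -(odd_card_odd_porbits (c * s)%g).
lia.
Qed.

(** The identity has [#|T|] odd orbits, and each factor lowers the count by at most 2. *)
Lemma prod_3cycles_lower_bound (T : finType) (k : nat) (s : {perm T}) :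
  prod_3cycles k s -> #|T| <= #|odd_porbits s| + k.*2.
Proof.
move=> /prod_3cyclesP[u [<- + ->]]; elim: u => [|c u IHu] /=.
  by rewrite big_nil card_odd_porbits1 addn0.
case/andP=> c3 /IHu/leq_trans-> //; rewrite big_cons doubleS -add2n addnA.
by rewrite leq_add2r odd_porbits_mul3.
Qed.

(** * Splitting even permutations into few 3-cycles *)

Lemma is_3cycle_tperm2 (T : finType) (x y z : T) :
  uniq [:: x; y; z] -> is_3cycle (tperm x y * tperm x z)%g.
Proof.
move=> u; apply/existsP; exists x; apply/existsP; exists y; apply/existsP; exists z.
rewrite u; move: u; rewrite /= !inE negb_or andbT => /andP[/andP[nxy nxz] nyz].
rewrite !permM tpermL tpermR tpermL (tpermD nxz nyz) tpermR (tpermD nxy) 1?eq_sym //.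
rewrite !eqxx /=; apply/forallP=> t; rewrite !inE !negb_or ![t == _]eq_sym permM.
by apply/implyP=> /and3P[nxt nyt nzt]; rewrite !tpermD.
Qed.

Lemma prod_3cycles_tperm2 (T : finType) (x y z : T) :
  uniq [:: x; y; z] -> prod_3cycles 1 (tperm x y * tperm x z)%g.
Proof.
move=> u; apply/prod_3cyclesP; exists [:: (tperm x y * tperm x z)%g].
by rewrite big_seq1 /= is_3cycle_tperm2.
Qed.

Definition moved (T : finType) (s : {perm T}) : {set T} := [set x | s x != x].

(** Measures the progress made by splitting off 3-cycles: [us] lists the newly fixed points, so
    [moved t] and [us] are disjoint parts of [moved s]. *)
Lemma card_moved_lt (T : finType) (s t : {perm T}) (us : seq T) :
    uniq us -> {subset us <= moved s} ->
    {in [predC us], forall x, s x = x -> t x = x} ->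
    {in us, forall x, t x = x} ->
  #|moved t| + size us <= #|moved s|.
Proof.
move=> uus us_s fix_t fix_us.
have <- : #|[set x in us]| = size us by rewrite cardsE; exact/card_uniqP.
rewrite -cardsUI.
have -> : moved t :&: [set x in us] = set0.
  apply/setP=> x; rewrite !inE; apply/negP=> /andP[/eqP tx /fix_us]; exact: tx.
rewrite cards0 addn0 subset_leq_card //; apply/subsetP=> x; rewrite !inE.
case/orP=> [tx|/us_s]; last by rewrite inE.
have [/us_s|nx] := boolP (x \in us); first by rewrite inE.
by apply: contra tx => /eqP sx; rewrite fix_t.
Qed.

Lemma prod_3cycles_upper_bound (T : finType) (s : {perm T}) :
  ~~ odd_perm s -> exists2 k, k.*2 <= #|moved s| & prod_3cycles k s.
Proof.
have [m] := ubnP #|moved s|; elim: m s => // m IHm s lt_m ev.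
(* If some orbit has at least three points, one 3-cycle along it is split off. *)
have [/existsP[x nx]|invs] := boolP [exists x, s (s x) != x].
  have nxy : s x != x by apply: contra nx => /eqP e; rewrite !e.
  have nyz : s (s x) != s x by rewrite (inj_eq perm_inj).
  set c := (tperm x (s x) * tperm x (s (s x)))%g.
  have u : uniq [:: x; s x; s (s x)].
    by rewrite /= !inE negb_or !(eq_sym x) nxy nx eq_sym nyz.
  (* This is the inverse of [c] followed by [s]; it fixes [s x] and [s (s x)]. *)
  pose s' := (tperm x (s (s x)) * tperm x (s x) * s)%g.
  have es : s = (c * s')%g.
    rewrite /s' /c !mulgA -[X in (X * _ * _)%g]mulgA tperm2 mulg1.
    by rewrite tperm2 mul1g.
  have ms' : #|moved s'| + 2 <= #|moved s|.
    apply: (@card_moved_lt _ _ _ [:: s x; s (s x)]).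
    - by case/andP: u.
    - by move=> t; rewrite !inE => /orP[] /eqP-> //; rewrite !(inj_eq perm_inj).
    - move=> t; rewrite !inE negb_or => /andP[ty tz] st.
      have tx : t != x by apply: contra nxy => /eqP <-; apply/eqP.
      by rewrite !permM tpermD 1?eq_sym // tpermD // eq_sym.
    - move=> t; rewrite !inE => /orP[] /eqP->; rewrite !permM.
        by rewrite (tpermD _ nyz) 1?eq_sym // tpermR.
      by rewrite tpermR tpermL.
  have ev' : ~~ odd_perm s'.
    move: ev; rewrite es /c !odd_permM !odd_tperm !(eq_sym x) nx nxy /=.
    by case: odd_perm.
  have [|k lek kP] := IHm s' _ ev'; first by lia.
  exists (1 + k); first by lia.
  by rewrite es; apply: prod_3cyclesM => //; exact: prod_3cycles_tperm2.
(* Otherwise [s] is an involution; being even, it contains two disjoint transpositions unless it is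
   trivial. *)
have inv_s x : s (s x) = x.
  by apply/eqP; apply: contraNT invs => nx; apply/existsP; exists x.
have [/eqP s1|ns1] := boolP (s == 1%g).
  by exists 0; rewrite // s1 prod_3cycles1.
have moves (t : {perm T}) : t != 1%g -> exists x, t x != x.
  move=> nt; apply/existsP; apply: contraNT nt; rewrite negb_exists => /forallP ft.
  by apply/eqP/permP=> x; rewrite perm1; apply/eqP; move: (ft x); rewrite negbK.
have [x nx] := moves _ ns1; pose y := s x.
have nxy : x != y by rewrite eq_sym.
pose s1 := (tperm x y * s)%g.
(* Removing one transposition leaves an odd permutation, which still moves a point. *)
have [z nz] : exists z, s1 z != z.
  apply: moves; apply/eqP=> /(congr1 (@odd_perm _)).
  by rewrite odd_permM odd_tperm odd_perm1 nxy (negPf ev).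
have zx : x != z.
  by apply: contra nz => /eqP<-; rewrite permM tpermL inv_s.
have zy : y != z.
  by apply: contra nz => /eqP<-; rewrite permM tpermR.
move: nz; rewrite permM tpermD // => nz; pose w := s z.
have wx : x != w by rewrite -(inj_eq (@perm_inj _ s)) inv_s.
have wy : y != w by rewrite (inj_eq perm_inj).
have nzw : z != w by rewrite eq_sym.
pose s' := (tperm z w * (tperm x y * s))%g.
(* Inserting [(x z)(z x) = 1] between [(x y)] and [(z w)] turns the pair into two 3-cycles. *)
have es : s = ((tperm x y * tperm x z) * (tperm z x * tperm z w) * s')%g.
  rewrite /s' (tpermC z x) !mulgA -[X in (X * _ * _ * _ * _)%g]mulgA tperm2 mulg1.
  rewrite -[X in (X * _ * _)%g]mulgA tperm2 mulg1.
  by rewrite tperm2 mul1g.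
have ms' : #|moved s'| + 4 <= #|moved s|.
  apply: (@card_moved_lt _ _ _ [:: x; y; z; w]).
  - by rewrite /= !inE !negb_or nxy zx wx zy wy nzw.
  - by move=> t; rewrite !inE => /or4P[] /eqP->; rewrite ?(inj_eq perm_inj).
  - move=> t; rewrite !inE !negb_or ![t == _]eq_sym => /and4P[tx ty tz tw] st.
    by rewrite !permM !tpermD.
  - move=> t; rewrite !inE => /or4P[] /eqP->; rewrite !permM.
    + by rewrite (tpermD (x := z)) 1?eq_sym // tpermL inv_s.
    + by rewrite (tpermD (x := z)) 1?eq_sym // tpermR.
    + by rewrite tpermL tpermD // inv_s.
    + by rewrite tpermR tpermD.
have ev' : ~~ odd_perm s'.
  by rewrite !odd_permM !odd_tperm nxy nzw (negPf ev).
have [|k lek kP] := IHm s' _ ev'; first by lia.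
exists (1 + 1 + k); first by lia.
rewrite es; apply: prod_3cyclesM => //; apply: prod_3cyclesM.
  by apply: prod_3cycles_tperm2; rewrite /= !inE negb_or nxy zx zy.
by apply: prod_3cycles_tperm2; rewrite /= !inE negb_or eq_sym zx nzw wx.
Qed.

(** * Bounds for [h_perm] and [h_coset] *)

Lemma h_perm_upper_bound (T : finType) (s : {perm T}) :
  (s \in 'Alt_T)%g -> (h_perm s).*2 <= #|T|.
Proof.
move=> As; rewrite /h_perm; case: ex_minnP => h _ minh.
have [|k lek kP] := @prod_3cycles_upper_bound T s; first by rewrite -Alt_even.
have lehk : h <= k by apply: minh; rewrite As kP.
by rewrite (leq_trans _ (max_card (moved s))) // (leq_trans _ lek) // leq_double.
Qed.

Lemma h_perm_lower_bound (T : finType) (s : {perm T}) :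
  (s \in 'Alt_T)%g -> #|T| <= #|odd_porbits s| + (h_perm s).*2.
Proof.
move=> As; rewrite /h_perm; case: ex_minnP => h; rewrite As /= => hP _.
exact: prod_3cycles_lower_bound.
Qed.

Lemma h_coset_upper_bound (n : nat) (s : {perm 'I_n}) :
  h_coset s <= h_perm s.
Proof.
rewrite /h_coset; apply: (big_rec (fun m => m <= h_perm s)) => // t m _ le_m.
by rewrite geq_min le_m orbT.
Qed.

Lemma h_coset_lower_bound (n b : nat) (s : {perm 'I_n}) :
  (forall j, b <= h_perm (shift n ^+ j * s)%g) -> b <= h_coset s.
Proof.
move=> le_b; rewrite /h_coset; apply: (big_rec (leq b)) => [|t m].
  (* The default value [h_perm s] of the minimum is the case [j = 0]. *)
  by have := le_b 0; rewrite mul1g.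
by case/rcosetP=> _ /cycleP[j ->] -> le_m; rewrite leq_min le_b.
Qed.

(** * The coset of the reflection *)

Lemma shiftXE (n k : nat) (x : 'I_n) : (shift n ^+ k)%g x = (x + k) %% n :> nat.
Proof.
elim: k => [|k IHk]; first by rewrite expg0 perm1 addn0 modn_small.
by rewrite expgSr permM permE /= IHk -addn1 modnDml addn1 addnS.
Qed.

Definition rev_perm (n : nat) : {perm 'I_n} := perm (@rev_ord_inj n).

(** Modulo [n] the map is [x |-> -1 - j - x]. *)
Lemma shiftX_rev_involutive (n j : nat) :
  involutive (shift n ^+ j * rev_perm n)%g.
Proof.
move=> x; apply/ord_inj; rewrite !permM ![rev_perm n _]permE /= !shiftXE /= shiftXE.
have lt_xn := ltn_ord x; have n_gt0 : 0 < n by lia.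
have lt_m := ltn_pmod (x + j) n_gt0.
suff -> : (n - ((x + j) %% n).+1 + j) %% n = n - x.+1 by lia.
rewrite -[RHS](modn_small (d := n)); last by lia.
(* Adding this term to both sides cancels the truncated subtraction on the left. *)
apply/eqP; rewrite -(eqn_modDr ((x + j) %% n).+1).
have -> : n - x.+1 + ((x + j) %% n).+1 = n - x + (x + j) %% n by lia.
by rewrite modnDmr; apply/eqP; congr (_ %% _); lia.
Qed.

(** The orbits are the sets [{x, s x}], which have odd size only at fixed points. *)
Lemma odd_porbits_involution (T : finType) (s : {perm T}) :
  involutive s -> #|odd_porbits s| <= #|[set x | s x == x]|.
Proof.
move=> inv_s.
have sub : odd_porbits s \subset [set porbit s x | x in [set x | s x == x]].
  apply/subsetP=> A; rewrite inE => /andP[/imsetP[x _ ->] ox].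
  apply: imset_f; rewrite inE; apply: contraLR ox => nx.
  have -> : porbit s x = [set x; s x].
    apply/setP=> y; rewrite !inE; apply/porbitP/orP=> [[i ->]|].
      elim: i => [|i IHi]; first by left; rewrite expg0 perm1.
      by rewrite expgSr permM; case: IHi => /eqP->; rewrite ?inv_s ?eqxx; [right|left].
    by case=> /eqP->; [exists 0; rewrite perm1 | exists 1; rewrite expg1].
  by rewrite cards2 eq_sym nx.
by apply: leq_trans (subset_leq_card sub) (leq_imset_card _ _).
Qed.

Lemma odd_porbits_shiftX_rev (n j : nat) : odd n ->
  #|odd_porbits (shift n ^+ j * rev_perm n)%g| <= 1.
Proof.
move=> on; apply: leq_trans (odd_porbits_involution (@shiftX_rev_involutive n j)) _.
apply/card_le1_eqP=> x y; rewrite !inE => /eqP fx /eqP fy; apply/ord_inj.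
(* A fixed point solves a congruence with leading coefficient 2, which is invertible modulo the odd
   [n]. *)
have fixE (z : 'I_n) : (shift n ^+ j * rev_perm n)%g z = z ->
    z.*2 + j = n.-1 %[mod n].
  move/(congr1 val); rewrite permM permE /= shiftXE => zE.
  have ltz : (z + j) %% n < n by rewrite ltn_mod; case: (n) z {zE} => // -[].
  by rewrite -addnn -addnA -modnDmr; congr (_ %% _); lia.
have /eqP := etrans (fixE x fx) (esym (fixE y fy)); rewrite eqn_modDr.
wlog lexy : x y {fx fy} / y <= x => [hw|].
  by case: (leqP y x) => [/hw|/ltnW/hw e]; [exact | rewrite eq_sym => /e].
rewrite eqn_mod_dvd ?leq_double // -doubleB -mul2n Gauss_dvdr ?coprimen2 //.
have := ltn_ord x; case: (posnP (x - y)) => [|pos ltx /(dvdn_leq pos)]; lia.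
Qed.

(** The two permutations differ at most at the preimages of [a] and [b] under [s]. *)
Lemma odd_porbits_mul_tperm (T : finType) (s : {perm T}) (a b : T) :
  #|odd_porbits (s * tperm a b)%g| <= #|odd_porbits s| + 2.
Proof.
have est : {in ~: (s @^-1: [set a; b]), (s * tperm a b)%g =1 s}.
  move=> x; rewrite !inE negb_or ![s x == _]eq_sym permM.
  by case/andP=> ? ?; rewrite tpermD.
apply: leq_trans (card_odd_porbits_le est) _; rewrite leq_add2l.
by rewrite card_preimset ?cards2; [case: eqP | exact: perm_inj].
Qed.

Lemma exists_few_odd_porbits (n : nat) : odd n -> 1 < n ->
  exists2 s : {perm 'I_n}, (s \in 'Alt_('I_n))%g
    & forall j, #|odd_porbits (shift n ^+ j * s)%g| <= 3.
Proof.
move=> on n_gt1; have [ev|od] := boolP (rev_perm n \in 'Alt_('I_n))%g.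
  by exists (rev_perm n) => // j; apply: leq_trans (odd_porbits_shiftX_rev j on) _.
(* The transposition [(0 1)] corrects the parity of [rev_perm n]. *)
pose t := tperm (Ordinal (ltnW n_gt1)) (Ordinal n_gt1).
exists (rev_perm n * t)%g => [|j].
  by move: od; rewrite !Alt_even odd_permM odd_tperm; case: odd_perm.
rewrite mulgA; apply: leq_trans (odd_porbits_mul_tperm _ _ _) _.
by rewrite (leq_add2r 2 _ 1) odd_porbits_shiftX_rev.
Qed.

Theorem theorem2p9 (n : nat) (hn : n = 3 %[mod 4]) :
  h_max n = (n - 3) %/ 2 \/ h_max n = (n - 1) %/ 2.
Proof.
have on : odd n by lia.
have le_h : (h_max n).*2 <= n.
  rewrite /h_max; apply: (big_ind (fun m => m.*2 <= n)) => [|a b|s As] //.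
    by move=> *; case: (leqP a b).
  have := h_perm_upper_bound As; rewrite card_ord.
  by apply: leq_trans; rewrite leq_double h_coset_upper_bound.
have [|s As odds] := exists_few_odd_porbits on; first by lia.
have ge_h : (n - 3) %/ 2 <= h_max n.
  apply: leq_trans (leq_bigmax_cond _ As); apply: h_coset_lower_bound => j.
  have Ajs : (shift n ^+ j * s \in 'Alt_('I_n))%g.
    by rewrite groupM // groupX // shift_Alt.
  have := h_perm_lower_bound Ajs; rewrite card_ord; have := odds j; lia.
(* For [n] odd and at least 3, [(n - 3) %/ 2] and [(n - 1) %/ 2] are consecutive integers, and
   [le_h] and [ge_h] confine [h_max n] to them. *)
lia.
Qed.
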